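(* Let $n\ge1$ and let $f:X\to Y$ be a map in $\mathsf{Cat}^n_{\mathsf{hd}}$. Then $f$ is an $n$-equivalence if and only if the map $f^d:X^d\to Y^d$ induced by $f$ is an isomorphism, $X^d\cong Y^d$.
   Context: **$n$-fold categories.** $\mathsf{Cat}^0=\mathsf{Set}$, $\mathsf{Cat}^1=\mathsf{Cat}$ (small categories and functors), and $\mathsf{Cat}^n=\mathsf{Cat}(\mathsf{Cat}^{n-1})$ is the category of internal categories and internal functors in $\mathsf{Cat}^{n-1}$. Iterating the nerve gives the fully faithful multinerve $N_{(n)}:\mathsf{Cat}^n\to[(\Delta^{op})^n,\mathsf{Set}]$, and via it we identify $\mathsf{Cat}^n$ with the full subcategory of $n$-simplicial sets $X$ whose Segal maps in each of the $n$ simplicial directions are isomorphisms. For $X\in\mathsf{Cat}^n$ and $s\ge 0$, $X_s\in\mathsf{Cat}^{n-1}$ denotes $X(s,-,\dots,-)$; thus $\mathsf{Cat}^n$ is the category of simplicial objects in $\mathsf{Cat}^{n-1}$ whose Segal maps are isomorphisms. $X_{s_1\dots s_{n-1}}\in\mathsf{Cat}$ denotes the category whose nerve is $X(s_1,\dots,s_{n-1},-)$. An $n$-fold category is discrete if its multinerve is a constant functor. **Homotopically discrete $n$-fold categories.** Let $p:\mathsf{Cat}\to\mathsf{Set}$ send a category to its set of isomorphism classes of objects. Set $\mathsf{Cat}^0_{\mathsf{hd}}=\mathsf{Set}$, let $\mathsf{Cat}^1_{\mathsf{hd}}=\mathsf{Cat}_{\mathsf{hd}}$ be the full subcategory of $\mathsf{Cat}$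 of equivalence relations (groupoids equivalent to discrete categories), and let $p^{(1)}$ be the restriction of $p$. Inductively, for $n\ge2$, $\mathsf{Cat}^n_{\mathsf{hd}}$ is the full subcategory of $[\Delta^{op},\mathsf{Cat}^{n-1}_{\mathsf{hd}}]$ on those $X$ such that (i) the Segal maps $X_s\to X_1\times_{X_0}\overset{s}{\cdots}\times_{X_0}X_1$ are isomorphisms for all $s\ge 2$ (so $X\in\mathsf{Cat}^n$); (ii) the simplicial object $s\mapsto p^{(n-1)}(X_s)$ in $\mathsf{Cat}^{n-2}_{\mathsf{hd}}$ is (the nerve in the first direction of) an object of $\mathsf{Cat}^{n-1}_{\mathsf{hd}}$; this object is denoted $p^{(n)}X$, giving a functor $p^{(n)}:\mathsf{Cat}^n_{\mathsf{hd}}\to\mathsf{Cat}^{n-1}_{\mathsf{hd}}$. Equivalently, $(p^{(n)}X)_{s_1\dots s_{n-1}}=p(X_{s_1\dots s_{n-1}})$. **Discretization.** Let $d:\mathsf{Set}\to\mathsf{Cat}$ be the discrete category functor, and let $d^{(n)}:\mathsf{Cat}^{n-1}\to\mathsf{Cat}^n$ be the discrete inclusion in the $n$-th direction: $(d^{(n)}Y)_{s_1\dots s_{n-1}}=d(Y_{s_1\dots s_{n-1}})$, with $d^{(1)}=d$. For $X\in\mathsf{Cat}^n_{\mathsf{hd}}$ let $\gamma^{(n)}_X:X\to d^{(n)}p^{(n)}X$ be given levelwise by the canonical functors $X_{s_1\dots s_{n-1}}\to d\,p\,X_{s_1\dots s_{n-1}}$ (sending each object to its isomorphism class). Put $X^d=d^{(n)}\cdots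 d^{(1)}p^{(1)}\cdots p^{(n)}X$ (a discrete $n$-fold category), and for a map $f$ let $f^d=d^{(n)}\cdots d^{(1)}p^{(1)}\cdots p^{(n)}f$. Let $\gamma_{(n)}:X\to X^d$ be the composite $X\xrightarrow{\gamma^{(n)}}d^{(n)}p^{(n)}X\xrightarrow{d^{(n)}\gamma^{(n-1)}}d^{(n)}d^{(n-1)}p^{(n-1)}p^{(n)}X\to\cdots\to X^d$. **$n$-equivalences.** A $1$-equivalence in $\mathsf{Cat}^1_{\mathsf{hd}}$ is an equivalence of categories. For $n\ge2$, $X\in\mathsf{Cat}^n_{\mathsf{hd}}$ and $a,b\in X_0^d=(X_0)^d$ (elements of the underlying set), $X(a,b)$ is the fiber at $(a,b)$ of the composite $X_1\xrightarrow{(d_0,d_1)}X_0\times X_0\xrightarrow{\gamma\times\gamma}X_0^d\times X_0^d$, where $\gamma=\gamma_{(n-1)}:X_0\to X_0^d$ is the discretization map of $X_0\in\mathsf{Cat}^{n-1}_{\mathsf{hd}}$. A map $f:X\to Y$ in $\mathsf{Cat}^n_{\mathsf{hd}}$ is an $n$-equivalence if for all $a,b\in X_0^d$ the induced map $f(a,b):X(a,b)\to Y(fa,fb)$ is an $(n-1)$-equivalence and $p^{(n)}f$ is an $(n-1)$-equivalence. *)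

(* Defs.v *)
From HB Require Import structures.
From Stdlib Require Import Relations.
From mathcomp Require Import all_boot generic_quotient boolp.

Set Implicit Arguments.
Unset Strict Implicit.
Unset Printing Implicit Defensive.

Definition monotone m n (f : {ffun 'I_m.+1 -> 'I_n.+1}) : bool :=
  [forall i : 'I_m.+1, forall j : 'I_m.+1, (i <= j) ==> (f i <= f j)].

Definition dhom m n := {f : {ffun 'I_m.+1 -> 'I_n.+1} | monotone f}.

Definition dfun m n (f : dhom m n) : 'I_m.+1 -> 'I_n.+1 := val f.
Coercion dfun : dhom >-> Funclass.

Lemma dhom_homo m n (f : dhom m n) : {homo f : i j / i <= j}.
Proof.
case: f => f hf i j ij; rewrite /dfun /=.
by have /forallP /(_ i) /forallP /(_ j) /implyP := hf; apply.
Qed.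

Lemma dhomP m n (f g : dhom m n) : f =1 g -> f = g.
Proof. by move=> h; apply/val_inj/ffunP. Qed.

Lemma dmk_subproof m n (f : 'I_m.+1 -> 'I_n.+1) :
  {homo f : i j / i <= j} -> monotone [ffun i => f i].
Proof.
by move=> h; apply/forallP => i; apply/forallP => j; apply/implyP; rewrite !ffunE; apply: h.
Qed.

Definition dmk m n (f : 'I_m.+1 -> 'I_n.+1) (h : {homo f : i j / i <= j}) :
  dhom m n := Sub [ffun i => f i] (dmk_subproof h).

Lemma dmkE m n (f : 'I_m.+1 -> 'I_n.+1) (h : {homo f : i j / i <= j}) i :
  dmk h i = f i.
Proof. by rewrite /dfun /= ffunE. Qed.

Definition did n : dhom n n := @dmk n n id (fun _ _ h => h).

Definition dcomp m n p (g : dhom n p) (f : dhom m n) : dhom m p :=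
  @dmk m p (fun i => g (f i)) (fun _ _ h => dhom_homo g (dhom_homo f h)).

Lemma dcomp1f m n (f : dhom m n) : dcomp (did n) f = f.
Proof. by apply: dhomP => i; rewrite !dmkE. Qed.

Lemma dcompf1 m n (f : dhom m n) : dcomp f (did m) = f.
Proof. by apply: dhomP => i; rewrite !dmkE. Qed.

Lemma dcompA m n p q (h : dhom p q) (g : dhom n p) (f : dhom m n) :
  dcomp h (dcomp g f) = dcomp (dcomp h g) f.
Proof. by apply: dhomP => i; rewrite !dmkE. Qed.

Lemma dface_subproof n (i : 'I_n.+2) : {homo lift i : j k / j <= k}.
Proof. by move=> j k h; rewrite /= leq_bump2. Qed.

(* The coface map [n] -> [n+1] omitting i. *)
Definition dface n (i : 'I_n.+2) : dhom n n.+1 := dmk (@dface_subproof n i).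

(* The vertex [0] -> [k] at i. *)
Definition dvert k (i : 'I_k.+1) : dhom 0 k := @dmk 0 k (fun=> i) (fun _ _ _ => leqnn i).

Definition dterm k : dhom k 0 := @dmk k 0 (fun=> ord0) (fun _ _ _ => leqnn 0).

Lemma dspine_subproof k (i : 'I_k) :
  {homo (fun j : 'I_2 => inord (i + j) : 'I_k.+1) : a b / a <= b}.
Proof.
move=> a b ab /=; have h (c : 'I_2) : i + c < k.+1.
  have h := leq_add (leqnn i) (leq_ord c); rewrite addn1 in h.
  by rewrite ltnS; exact: leq_trans h (ltn_ord i).
by rewrite !inordK // leq_add2l.
Qed.

(* The edge [1] -> [k] from i to i+1. *)
Definition dspine k (i : 'I_k) : dhom 1 k := dmk (@dspine_subproof k i).

(* [idx n] and [mor] are the objects and morphisms of Delta^n. *)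
Fixpoint idx n : Type := if n is n'.+1 then (nat * idx n')%type else unit.

Fixpoint mor n : idx n -> idx n -> Type :=
  match n with
  | 0 => fun _ _ => unit
  | n'.+1 => fun s t => (dhom s.1 t.1 * mor s.2 t.2)%type
  end.

Fixpoint mid n : forall s : idx n, mor s s :=
  match n with
  | 0 => fun _ => tt
  | n'.+1 => fun s => (did s.1, mid s.2)
  end.

Fixpoint mcomp n : forall r s t : idx n, mor s t -> mor r s -> mor r t :=
  match n with
  | 0 => fun _ _ _ _ _ => tt
  | n'.+1 => fun r s t g f => (dcomp g.1 f.1, mcomp g.2 f.2)
  end.

Lemma mcomp1f n (s t : idx n) (f : mor s t) : mcomp (mid t) f = f.
Proof.
elim: n s t f => [|n IH] s t; first by case.
by case=> f g /=; rewrite dcomp1f IH.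
Qed.

Lemma mcompf1 n (s t : idx n) (f : mor s t) : mcomp f (mid s) = f.
Proof.
elim: n s t f => [|n IH] s t; first by case.
by case=> f g /=; rewrite dcompf1 IH.
Qed.

Lemma mcompA n (q r s t : idx n) (h : mor s t) (g : mor r s) (f : mor q r) :
  mcomp h (mcomp g f) = mcomp (mcomp h g) f.
Proof. by elim: n q r s t h g f => [|n IH] //= q r s t h g f; rewrite dcompA IH. Qed.

(* (0, ..., 0), the terminal object of Delta^n. *)
Fixpoint zeros n : idx n := if n is n'.+1 then (0, zeros n') else tt.

Fixpoint mterm n : forall s : idx n, mor s (zeros n) :=
  match n with
  | 0 => fun _ => tt
  | n'.+1 => fun s => (dterm s.1, mterm s.2)
  end.

Lemma mtermP n (s : idx n) (f : mor s (zeros n)) : f = mterm s.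
Proof.
elim: n s f => [|n IH] s /=; first by case.
case=> f g /=; rewrite (IH _ g); congr pair.
by apply: dhomP => i; rewrite dmkE ord1.
Qed.

(* The isomorphism Delta^(n-1) x Delta = Delta^n splitting off the last factor. *)
Fixpoint snoc n : idx n -> nat -> idx n.+1 :=
  match n with
  | 0 => fun _ k => (k, tt)
  | n'.+1 => fun t k => (t.1, snoc t.2 k)
  end.

Fixpoint init n : idx n.+1 -> idx n :=
  match n with
  | 0 => fun _ => tt
  | n'.+1 => fun s => (s.1, init s.2)
  end.

Fixpoint msnoc n : forall (s t : idx n) k l, mor s t -> dhom k l ->
    mor (snoc s k) (snoc t l) :=
  match n with
  | 0 => fun _ _ _ _ _ g => (g, tt)
  | n'.+1 => fun s t k l f g => (f.1, msnoc f.2 g)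
  end.

Fixpoint minit n : forall s t : idx n.+1, mor s t -> mor (init s) (init t) :=
  match n with
  | 0 => fun _ _ _ => tt
  | n'.+1 => fun s t f => (f.1, minit f.2)
  end.

(* The identity in the first n directions, and the vertex 0 in the last one. *)
Fixpoint mvert n : forall s : idx n.+1, mor (snoc (init s) 0) s :=
  match n with
  | 0 => fun s => (dvert ord0, tt)
  | n'.+1 => fun s => (did s.1, mvert s.2)
  end.

Lemma msnoc_id n (s : idx n) k : msnoc (mid s) (did k) = mid (snoc s k).
Proof. by elim: n s => [|n IH] //= s; rewrite IH. Qed.

Lemma msnoc_comp n (r s t : idx n) j k l (g : mor s t) (f : mor r s)
    (v : dhom k l) (u : dhom j k) :
  msnoc (mcomp g f) (dcomp v u) = mcomp (msnoc g v) (msnoc f u).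
Proof. by elim: n r s t g f => [|n IH] //= r s t g f; rewrite IH. Qed.

Lemma minit_id n (s : idx n.+1) : minit (mid s) = mid (init s).
Proof. by elim: n s => [|n IH] //= s; rewrite -IH. Qed.

Lemma minit_comp n (r s t : idx n.+1) (g : mor s t) (f : mor r s) :
  minit (mcomp g f) = mcomp (minit g) (minit f).
Proof. by elim: n r s t g f => [|n IH] //= r s t g f; rewrite -IH. Qed.

(* An n-simplicial set, i.e. a functor (Delta^n)^op -> Set; n-fold categories are
   identified with their multinerves, and their maps with [msmap]. *)
Record msset n := MSset {
  lev :> idx n -> Type;
  act : forall s t, mor s t -> lev t -> lev s;
  act_id : forall s x, act (mid s) x = x;
  act_comp : forall r s t (g : mor s t) (f : mor r s) x,
    act (mcomp g f) x = act f (act g x)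
}.
Arguments act {n} m {s t} f x.

Record msmap n (X Y : msset n) := MSmap {
  mapf :> forall s, X s -> Y s;
  map_act : forall s t (f : mor s t) x, mapf (act X f x) = act Y f (mapf x)
}.

Definition idmap n (X : msset n) : msmap X X :=
  @MSmap n X X (fun _ x => x) (fun _ _ _ _ => erefl).

Lemma compmap_subproof n (X Y Z : msset n) (g : msmap Y Z) (f : msmap X Y)
    s t (u : mor s t) x : g s (f s (act X u x)) = act Z u (g t (f t x)).
Proof. by rewrite !map_act. Qed.

Definition compmap n (X Y Z : msset n) (g : msmap Y Z) (f : msmap X Y) : msmap X Z :=
  MSmap (compmap_subproof g f).

Definition is_iso n (X Y : msset n) (f : msmap X Y) : Prop :=
  exists g : msmap Y X, (forall s, cancel (f s) (g s)) /\ (forall s, cancel (g s) (f s)).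

(* X_k = X(k, -, ..., -). *)
Definition slice n (X : msset n.+1) (k : nat) : msset n.
Proof.
refine (@MSset n (fun t => X (k, t)) (fun s t f => @act _ X (k, s) (k, t) (did k, f)) _ _).
- by move=> s x; exact: act_id.
- by move=> r s t g f x; rewrite -act_comp /= dcomp1f.
Defined.

Definition slice_op n (X : msset n.+1) k l (f : dhom k l) : msmap (slice X l) (slice X k).
Proof.
refine (@MSmap n (slice X l) (slice X k) (fun t => @act _ X (k, t) (l, t) (f, mid t)) _).
by move=> s t u x /=; rewrite -!act_comp /= dcomp1f dcompf1 mcomp1f mcompf1.
Defined.

Definition slice_map n (X Y : msset n.+1) (f : msmap X Y) k : msmap (slice X k) (slice Y k).
Proof.
refine (@MSmap n (slice X k) (slice Y k) (fun t => f (k, t)) _).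
by move=> s t u x /=; rewrite map_act.
Defined.

(* The simplicial set X(t_1, ..., t_n, -). *)
Definition row n (X : msset n.+1) (t : idx n) : msset 1.
Proof.
refine (@MSset 1 (fun k => X (snoc t k.1)) (fun k l f => act X (msnoc (mid t) f.1)) _ _).
- by move=> k x /=; rewrite msnoc_id act_id.
- by move=> j k l g f x /=; rewrite -act_comp -msnoc_comp mcomp1f.
Defined.

Definition row_op n (X : msset n.+1) s t (f : mor s t) : msmap (row X t) (row X s).
Proof.
refine (@MSmap 1 (row X t) (row X s) (fun k => act X (msnoc f (did k.1))) _).
by move=> k l g x /=; rewrite -!act_comp -!msnoc_comp mcomp1f mcompf1 dcomp1f dcompf1.
Defined.

Definition row_map n (X Y : msset n.+1) (f : msmap X Y) t : msmap (row X t) (row Y t).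
Proof.
refine (@MSmap 1 (row X t) (row Y t) (fun k => f (snoc t k.1)) _).
by move=> k l g x /=; rewrite map_act.
Defined.

(* d0 is the target and d1 the source of an edge. *)
Definition sd0 n (X : msset n.+1) : msmap (slice X 1) (slice X 0) :=
  slice_op X (dface (ord0 : 'I_2)).
Definition sd1 n (X : msset n.+1) : msmap (slice X 1) (slice X 0) :=
  slice_op X (dface (ord_max : 'I_2)).

(* The level t of the iterated pullback X_1 x_{X_0} ... x_{X_0} X_1; limits of
   multisimplicial sets are computed levelwise. *)
Definition chain n (X : msset n.+1) k (t : idx n) : Type :=
  {x : 'I_k -> slice X 1 t |
    forall i j : 'I_k, j = i.+1 :> nat -> sd0 X t (x i) = sd1 X t (x j)}.

Lemma segal_subproof n (X : msset n.+1) k t (x : slice X k t) (i j : 'I_k) :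
  j = i.+1 :> nat ->
  sd0 X t (slice_op X (dspine i) t x) = sd1 X t (slice_op X (dspine j) t x).
Proof.
move=> ij /=; rewrite -!act_comp /=.
suff -> : dcomp (dspine i) (dface ord0) = dcomp (dspine j) (dface ord_max) by [].
apply: dhomP => a; rewrite !dmkE !ord1; congr (inord _).
by rewrite ij /= /bump /= !addn0 addn1.
Qed.

Definition segal_map n (X : msset n.+1) k t (x : slice X k t) : chain X k t :=
  exist _ (fun i => slice_op X (dspine i) t x) (@segal_subproof n X k t x).

Definition segal n (X : msset n.+1) : Prop :=
  forall k t, 2 <= k -> bijective (@segal_map n X k t).

(* A category is identified with its nerve, a simplicial set satisfying [segal],
   and a functor with a simplicial map.  The vocabulary of category theory is
   spelled out on the nerve, and makes sense for any simplicial set. *)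

Section Categories.
Variable X : msset 1.

Definition ob := X (0, tt).
Definition arr := X (1, tt).
Definition src (u : arr) : ob := sd1 X tt u.
Definition tgt (u : arr) : ob := sd0 X tt u.
Definition idar (x : ob) : arr := slice_op X (dterm 1) tt x.

(* w = v o u, witnessed by a 2-simplex. *)
Definition composite (u v w : arr) : Prop :=
  exists z : X (2, tt),
    [/\ slice_op X (dface (inord 2 : 'I_3)) tt z = u,
        slice_op X (dface (inord 0 : 'I_3)) tt z = v
      & slice_op X (dface (inord 1 : 'I_3)) tt z = w].

Definition invertible (u : arr) : Prop :=
  exists v, composite u v (idar (src u)) /\ composite v u (idar (tgt u)).

Definition isomorphic (x y : ob) : Prop :=
  exists u, [/\ src u = x, tgt u = y & invertible u].

Definition groupoid : Prop := segal X /\ forall u, invertible u.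

End Categories.

Ltac hom_tac :=
  let i := fresh in let h := fresh in
  intros [i h]; apply: val_inj; rewrite ?dmkE -?val_eqE /= ?inordK //;
  do 4 (destruct i as [|i]; [rewrite /= /bump /= ?inordK //=|]); try by [].

Section IsoEquivalence.
Variables (X : msset 1) (hX : segal X).

Lemma slice_op_comp j k l (f : dhom j k) (g : dhom k l) (z : X (l, tt)) :
  slice_op X f tt (slice_op X g tt z) = slice_op X (dcomp g f) tt z.
Proof. by rewrite /= -act_comp. Qed.

Lemma spine_inj k (z z' : X (k, tt)) : 2 <= k ->
  (forall i : 'I_k, slice_op X (dspine i) tt z = slice_op X (dspine i) tt z') -> z = z'.
Proof.
move=> k2 e; apply: (bij_inj (hX tt k2)); apply: eq_exist; apply: funext => i; exact: e.
Qed.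

Lemma spine20 : dspine (ord0 : 'I_2) = dface (inord 2 : 'I_3).
Proof. apply: dhomP; hom_tac. Qed.
Lemma spine21 : dspine (ord_max : 'I_2) = dface (inord 0 : 'I_3).
Proof. apply: dhomP; hom_tac. Qed.

Lemma ord2P (P : 'I_2 -> Prop) : P ord0 -> P ord_max -> forall i, P i.
Proof.
move=> h0 h1 [[|[|//]] h]; [move: h0|move: h1]; congr P; exact: val_inj.
Qed.

Lemma composite_uniq (u v w w' : arr X) : composite u v w -> composite u v w' -> w = w'.
Proof.
move=> [z [z2 z0 z1]] [z' [z2' z0' z1']].
suff e : z = z' by rewrite -z1 -z1' e.
apply: spine_inj => //; apply: ord2P; rewrite ?spine20 ?spine21.
  by rewrite z2 z2'.
by rewrite z0 z0'.
Qed.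

Lemma composite_ex (u v : arr X) : tgt u = src v -> exists w, composite u v w.
Proof.
move=> e; have [h hK Kh] := hX tt (isT : 2 <= 2).
pose x i := if i == ord0 :> 'I_2 then u else v.
have hx (i j : 'I_2) : j = i.+1 :> nat -> sd0 X tt (x i) = sd1 X tt (x j).
  by case: i j => [[|[|?]] ?] [[|[|?]] ?] //= _; rewrite /x /=.
have ex i := congr1 (fun c : chain X 2 tt => sval c i) (Kh (exist _ x hx)).
exists (slice_op X (dface (inord 1 : 'I_3)) tt (h (exist _ x hx))), (h (exist _ x hx)).
by split=> //; [rewrite -spine20; exact: ex ord0|rewrite -spine21; exact: ex ord_max].
Qed.

Lemma slice_opE k l (f g : dhom k l) (z : X (l, tt)) :
  f =1 g -> slice_op X f tt z = slice_op X g tt z.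
Proof. by move/dhomP->. Qed.

Lemma slice_op1 k (f : dhom k k) (z : X (k, tt)) : f =1 did k -> slice_op X f tt z = z.
Proof. by move/slice_opE->; exact: act_id. Qed.

Lemma homo3 (T : nat) (g : 'I_3 -> 'I_T.+1) :
  g ord0 <= g (inord 1) -> g (inord 1) <= g ord_max -> {homo g : i j / i <= j}.
Proof.
move=> h1 h2 [i hi] [j hj] /=.
have e0 (h : 0 < 3) : Ordinal h = ord0 by exact: val_inj.
have e1 (h : 1 < 3) : Ordinal h = inord 1 by apply: val_inj; rewrite /= inordK.
have e2 (h : 2 < 3) : Ordinal h = ord_max by exact: val_inj.
case: i hi => [|[|[|//]]] hi; case: j hj => [|[|[|//]]] hj //= _; rewrite ?e0 ?e1 ?e2 //.
exact: leq_trans h1 h2.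
Qed.

Lemma composite_idl (u : arr X) : composite (idar (src u)) u u.
Proof.
have ho : {homo (fun i : 'I_3 => if i == ord_max then ord_max else ord0 : 'I_2) : i j / i <= j}.
  by apply: homo3 => //=; rewrite -!val_eqE /= inordK.
exists (slice_op X (dmk ho) tt u); rewrite /idar /src /sd1 !slice_op_comp.
split; [apply: slice_opE|apply: slice_op1|apply: slice_op1]; hom_tac.
Qed.

Lemma composite_idr (u : arr X) : composite u (idar (tgt u)) u.
Proof.
have ho : {homo (fun i : 'I_3 => if i == ord0 then ord0 else ord_max : 'I_2) : i j / i <= j}.
  by apply: homo3 => //=; rewrite -!val_eqE /= inordK.
exists (slice_op X (dmk ho) tt u); rewrite /idar /tgt /sd0 !slice_op_comp.
split; [apply: slice_op1|apply: slice_opE|apply: slice_op1]; hom_tac.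
Qed.

Lemma composite_src (u v w : arr X) : composite u v w -> src w = src u.
Proof.
case=> z [<- _ <-]; rewrite /src /sd1 !slice_op_comp; apply: slice_opE; hom_tac.
Qed.

Lemma composite_tgt (u v w : arr X) : composite u v w -> tgt w = tgt v.
Proof.
case=> z [_ <- <-]; rewrite /tgt /sd0 !slice_op_comp; apply: slice_opE; hom_tac.
Qed.

Lemma composite_mid (u v w : arr X) : composite u v w -> tgt u = src v.
Proof.
case=> z [<- <- _]; rewrite /src /tgt /sd0 /sd1 !slice_op_comp; apply: slice_opE; hom_tac.
Qed.

Lemma compositeA (u v w a b c : arr X) :
  composite u v a -> composite v w b -> composite a w c <-> composite u b c.
Proof.
move=> ha hb; have [h hK Kh] := hX tt (isT : 2 <= 3).
pose x (i : 'I_3) := if i == ord0 then u else if i == inord 1 then v else w.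
have hx (i j : 'I_3) : j = i.+1 :> nat -> sd0 X tt (x i) = sd1 X tt (x j).
  case: i j => [[|[|[|?]]] ?] [[|[|[|?]]] ?] //= _; rewrite /x -!val_eqE /= !inordK //=.
    exact: (composite_mid ha).
  exact: (composite_mid hb).
have ex i := congr1 (fun c : chain X 3 tt => sval c i) (Kh (exist _ x hx)).
move: (h _) ex => z ex.
pose D i := slice_op X (dface (i : 'I_4)) tt z.
have e0 : slice_op X (dspine ord0) tt z = u by rewrite [LHS]ex.
have e1 : slice_op X (dspine (inord 1)) tt z = v.
  by rewrite [LHS]ex /= /x -val_eqE /= eqxx inordK.
have e2 : slice_op X (dspine ord_max) tt z = w.
  by rewrite [LHS]ex /= /x -!val_eqE /= inordK.
have c3 : composite u v (slice_op X (dface (inord 1)) tt (D ord_max)).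
  exists (D ord_max); split=> //; rewrite /D ?slice_op_comp -?e0 -?e1; apply: slice_opE; hom_tac.
have c0 : composite v w (slice_op X (dface (inord 1)) tt (D ord0)).
  exists (D ord0); split=> //; rewrite /D ?slice_op_comp -?e2 -?e1; apply: slice_opE; hom_tac.
have E3 := composite_uniq c3 ha; have E0 := composite_uniq c0 hb.
pose m := slice_op X (dface (inord 1)) tt (D (inord 1)).
have d1 : composite a w m.
  exists (D (inord 1)); split=> //; rewrite /D ?slice_op_comp -?E3 -?e2 /D ?slice_op_comp;
    apply: slice_opE; hom_tac.
have d2 : composite u b m.
  exists (D (inord 2)); split=> //; rewrite /m /D ?slice_op_comp -?E0 -?e0 /D ?slice_op_comp;
    apply: slice_opE; hom_tac.
by split=> hc; [rewrite -(composite_uniq d1 hc)|rewrite -(composite_uniq d2 hc)].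
Qed.

Lemma src_idar x : src (idar x) = x :> ob X.
Proof. by rewrite /src /idar /sd1 slice_op_comp; apply: slice_op1; hom_tac. Qed.

Lemma tgt_idar x : tgt (idar x) = x :> ob X.
Proof. by rewrite /tgt /idar /sd0 slice_op_comp; apply: slice_op1; hom_tac. Qed.

Lemma composite_inv (u v w u' v' w' : arr X) x :
  composite u v w -> composite v' u' w' ->
  composite u u' (idar x) -> composite v v' (idar (src u')) -> composite w w' (idar x).
Proof.
move=> h h' hu hv; apply: (proj2 (compositeA _ h _) hu).
exact: (proj1 (compositeA _ hv h') (composite_idl u')).
Qed.

Lemma isomorphic_equivalence : equivalence (ob X) (@isomorphic X).
Proof.
split.
- move=> x; exists (idar x); rewrite src_idar tgt_idar; split=> //; exists (idar x).
  by have := composite_idl (idar x); rewrite src_idar tgt_idar.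
- move=> x y z [u [<- e [u' [h1 h2]]]] [v [e' <- [v' [k1 k2]]]].
  have eu' : src u' = src v by rewrite e' -e (composite_mid h1).
  have ev' : tgt v' = src v by rewrite -(composite_tgt k1) tgt_idar.
  have [w hw] := composite_ex (etrans e (esym e')).
  have [w' hw'] := composite_ex (etrans ev' (esym eu')).
  exists w; rewrite (composite_src hw) (composite_tgt hw); split=> //; exists w'.
  rewrite (composite_src hw) (composite_tgt hw); split.
    by apply: composite_inv hw hw' h1 _; rewrite eu'.
  by apply: composite_inv hw' hw k2 _; rewrite e' -e.
- move=> x y [u [<- <- [v [h1 h2]]]].
  have es : src v = tgt u by rewrite (composite_mid h1).
  have et : tgt v = src u by rewrite (composite_mid h2).
  by exists v; split=> //; exists u; rewrite es et.
Qed.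
End IsoEquivalence.

Section IsoClasses.
Variable X : msset 1.

(* [isomorphic] is already an equivalence relation when X satisfies [segal]
   (see [isomorphic_equivalence]); the closure is there because [p] below has to
   be defined before it is known to be applied to categories only. *)
Definition iso_rel : rel {classic (ob X)} :=
  fun x y => `[< clos_refl_sym_trans (ob X) (@isomorphic X) x y >].

Lemma iso_rel_refl : reflexive iso_rel.
Proof. by move=> x; apply/asboolP; exact: rst_refl. Qed.

Lemma iso_rel_sym : symmetric iso_rel.
Proof. by move=> x y; apply/asboolP/asboolP; exact: rst_sym. Qed.

Lemma iso_rel_trans : transitive iso_rel.
Proof. by move=> y x z /asboolP h1 /asboolP h2; apply/asboolP; exact: rst_trans h1 h2. Qed.

Definition iso_equiv := EquivRel iso_rel iso_rel_refl iso_rel_sym iso_rel_trans.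

(* The set of isomorphism classes of objects. *)
Definition iso_classes : Type := {eq_quot iso_equiv}%qT.

Definition iso_class (x : ob X) : iso_classes := (\pi_{eq_quot iso_equiv} (x : {classic (ob X)}))%qT.

Definition iso_repr (c : iso_classes) : ob X := (repr c : {classic (ob X)}).

Lemma iso_reprK c : iso_class (iso_repr c) = c.
Proof. exact: reprK. Qed.

Lemma iso_classP x y : iso_class x = iso_class y <-> clos_refl_sym_trans (ob X) (@isomorphic X) x y.
Proof.
split=> [|h]; first by move/eqmodP/asboolP.
by apply/eqmodP/asboolP.
Qed.

End IsoClasses.

Definition nat_iso (X Y : msset 1) (f g : msmap X Y) : Prop :=
  exists h : ob X -> arr Y,
    [/\ forall x, [/\ src (h x) = f (0, tt) x, tgt (h x) = g (0, tt) x & invertible (h x)]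
      & forall u : arr X, exists w,
          composite (f (1, tt) u) (h (tgt u)) w /\ composite (h (src u)) (g (1, tt) u) w].

Definition is_equivalence (X Y : msset 1) (f : msmap X Y) : Prop :=
  exists g : msmap Y X, nat_iso (compmap g f) (idmap X) /\ nat_iso (compmap f g) (idmap Y).

Section IsoClassesMap.
Variables (X Y : msset 1) (f : msmap X Y).

Lemma src_map u : src (f (1, tt) u) = f (0, tt) (src u).
Proof. by rewrite /src /= map_act. Qed.

Lemma tgt_map u : tgt (f (1, tt) u) = f (0, tt) (tgt u).
Proof. by rewrite /tgt /= map_act. Qed.

Lemma idar_map x : idar (f (0, tt) x) = f (1, tt) (idar x).
Proof. by rewrite /idar /= map_act. Qed.

Lemma composite_map u v w :
  composite u v w -> composite (f (1, tt) u) (f (1, tt) v) (f (1, tt) w).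
Proof. by case=> z [<- <- <-]; exists (f (2, tt) z); split; rewrite /= -map_act. Qed.

Lemma invertible_map u : invertible u -> invertible (f (1, tt) u).
Proof.
case=> v [h1 h2]; exists (f (1, tt) v); rewrite src_map tgt_map !idar_map.
by split; apply: composite_map.
Qed.

Lemma isomorphic_map x y : isomorphic x y -> isomorphic (f (0, tt) x) (f (0, tt) y).
Proof.
case=> u [<- <- h]; exists (f (1, tt) u).
by rewrite src_map tgt_map; split => //; apply: invertible_map.
Qed.

Definition iso_classes_map (c : iso_classes X) : iso_classes Y :=
  iso_class (f (0, tt) (iso_repr c)).

Lemma iso_classes_mapE x : iso_classes_map (iso_class x) = iso_class (f (0, tt) x).
Proof.
have gen a b : clos_refl_sym_trans (ob X) (@isomorphic X) a b ->
    clos_refl_sym_trans (ob Y) (@isomorphic Y) (f (0, tt) a) (f (0, tt) b).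
  elim=> {a b} [a b /isomorphic_map|a|a b _|a b c _ h _]; first exact: rst_step.
  - exact: rst_refl.
  - exact: rst_sym.
  - exact: rst_trans h.
by apply/iso_classP/gen/iso_classP/iso_reprK.
Qed.

End IsoClassesMap.

Lemma iso_classes_map_ext (X Y : msset 1) (f g : msmap X Y) :
  f (0, tt) =1 g (0, tt) -> iso_classes_map f =1 iso_classes_map g.
Proof. by move=> fg c; rewrite /iso_classes_map fg. Qed.

Definition p n (X : msset n.+1) : msset n.
Proof.
refine (@MSset n (fun t => iso_classes (row X t))
  (fun s t f => iso_classes_map (row_op X f)) _ _).
- move=> s c; rewrite -{1}(iso_reprK c) iso_classes_mapE /= msnoc_id act_id.
  exact: iso_reprK.
- move=> r s t g f c; rewrite -{1 2}(iso_reprK c) !iso_classes_mapE /=.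
  by rewrite -act_comp -msnoc_comp dcomp1f.
Defined.

Definition p_map n (X Y : msset n.+1) (f : msmap X Y) : msmap (p X) (p Y).
Proof.
refine (@MSmap n (p X) (p Y) (fun t => iso_classes_map (row_map f t)) _).
move=> s t u c /=; rewrite -(iso_reprK c) !iso_classes_mapE /=.
by rewrite map_act.
Defined.

Definition d n (Y : msset n) : msset n.+1.
Proof.
refine (@MSset n.+1 (fun s => Y (init s)) (fun s t f => act Y (minit f)) _ _).
- by move=> s x; rewrite minit_id act_id.
- by move=> r s t g f x; rewrite minit_comp act_comp.
Defined.

Definition d_map n (X Y : msset n) (f : msmap X Y) : msmap (d X) (d Y).
Proof.
refine (@MSmap n.+1 (d X) (d Y) (fun s => f (init s)) _).
by move=> s t u x /=; rewrite map_act.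
Defined.

Definition set_msset (S : Type) : msset 0 :=
  @MSset 0 (fun _ => S) (fun _ _ _ x => x) (fun _ _ => erefl) (fun _ _ _ _ _ _ => erefl).

(* The groupoids equivalent to a discrete category; [d (set_msset S)] is the
   constant simplicial set S. *)
Definition equiv_relation (X : msset 1) : Prop :=
  groupoid X /\ exists (S : Type) (g : msmap X (d (set_msset S))), is_equivalence g.


(* [hdS n X] says that the (n+1)-simplicial set X belongs to Cat^(n+1)_hd.  The
   simplicial object k |-> p (slice X k) is [p X]: at level (k, t) both are the
   set of isomorphism classes of X(k, t, -). *)
Fixpoint hdS n : msset n.+1 -> Prop :=
  match n with
  | 0 => fun X => equiv_relation X
  | n'.+1 => fun X => [/\ forall k, hdS (slice X k), segal X & hdS (p X)]
  end.

Definition hd n : msset n -> Prop :=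
  match n with
  | 0 => fun _ => True
  | n'.+1 => @hdS n'
  end.

Record hdcat n := HdCat { hdobj :> msset n; hdP : hd hdobj }.

Lemma hd_p n (X : hdcat n.+1) : hd (p X).
Proof. by case: n X => [|n] // [X /= []]. Qed.

Definition hdp n (X : hdcat n.+1) : hdcat n := HdCat (hd_p X).

Lemma hd_slice n (X : hdcat n.+2) k : hd (slice X k).
Proof. by case: X => X /= []. Qed.

Definition hdslice n (X : hdcat n.+2) k : hdcat n.+1 := HdCat (hd_slice X k).

Lemma hd_row n (X : msset n.+1) : hd X ->
  forall t (u : arr (row X t)), isomorphic (src u) (tgt u).
Proof.
elim: n X => [|n IH] X.
  by move=> [[_ h] _] [] u; exists u; split=> //; exact: h u.
by move=> [h _ _] [k t] u; exact: (IH (slice X k) (h k) t u).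
Qed.

Lemma gamma1_edge n (s t : idx n.+1) (f : mor s t) :
  exists e : mor (snoc (init s) 1) t,
    mcomp e (msnoc (mid (init s)) (dface (ord_max : 'I_2)))
      = mcomp (mvert t) (msnoc (minit f) (did 0)) /\
    mcomp e (msnoc (mid (init s)) (dface (ord0 : 'I_2))) = mcomp f (mvert s).
Proof.
elim: n s t f => [|n IH].
  move=> [k []] [l []] /= [f []].
  have ho : {homo (fun i : 'I_2 => if i == ord0 then ord0 else f ord0) :
      i j / i <= j}.
    move=> i j ij; case: (i =P ord0) => // i0; case: (j =P ord0) => // j0.
    by case: i0; apply: val_inj; move: ij; rewrite j0 /= leqn0 => /eqP.
  exists (dmk ho, tt); split; congr (_, tt); apply: dhomP => i;
    by rewrite (ord1 i) /= !dmkE.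
move=> [k s] [l t] [f g]; have [e [e1 e2]] := IH _ _ g.
exists (f, e); split; last exact: (f_equal2 pair (erefl _) e2).
by apply: (f_equal2 pair _ e1); rewrite dcompf1 dcomp1f.
Qed.

(* gamma^(n+1) : X -> d^(n+1) p^(n+1) X sends a simplex of X(t, -), that is, a
   chain of isomorphisms, to the class of its vertex 0. *)
Definition gamma1 n (X : hdcat n.+1) : msmap X (d (p X)).
Proof.
refine (@MSmap n.+1 X (d (p X))
  (fun s x => @iso_class (row X (init s)) (act X (mvert s) x)) _).
move=> s t f x; rewrite /= iso_classes_mapE /=; apply/esym/iso_classP/rst_step.
have [e [e1 e2]] := gamma1_edge f.
have := hd_row (hdP X) (act X e x : arr (row X (init s))).
by rewrite /src /tgt /= -!act_comp e1 e2.
Defined.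

(* [disc X] is X^d. *)
Fixpoint disc n : msset n -> msset n :=
  match n with
  | 0 => fun X => X
  | n'.+1 => fun X => d (disc (p X))
  end.

(* [disc_map f] is f^d. *)
Fixpoint disc_map n : forall X Y : msset n, msmap X Y -> msmap (disc X) (disc Y) :=
  match n with
  | 0 => fun _ _ f => f
  | n'.+1 => fun X Y f => d_map (disc_map (p_map f))
  end.

(* gamma_(n+1) is gamma^(n+1) followed by d^(n+1) of gamma_(n). *)
Fixpoint gamma n : forall X : hdcat n, msmap X (disc X) :=
  match n with
  | 0 => fun X => idmap X
  | n'.+1 => fun X => compmap (d_map (gamma (hdp X))) (gamma1 X)
  end.

Lemma gamma_natural n (X Y : hdcat n) (f : msmap X Y) s x :
  gamma Y s (f s x) = disc_map f s (gamma X s x).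
Proof.
elim: n X Y f s x => [|n IH] X Y f s x //=.
rewrite -(IH (hdp X) (hdp Y) (p_map f)) /=; apply: congr1.
by rewrite iso_classes_mapE /= map_act.
Qed.

Definition prodms n (X Y : msset n) : msset n.
Proof.
refine (@MSset n (fun t => X t * Y t)%type (fun s t f x => (act X f x.1, act Y f x.2)) _ _).
- by move=> s [x y]; rewrite !act_id.
- by move=> r s t g f [x y]; rewrite !act_comp.
Defined.

Definition pairmap n (Z X Y : msset n) (f : msmap Z X) (g : msmap Z Y) :
  msmap Z (prodms X Y).
Proof.
refine (@MSmap n Z (prodms X Y) (fun t z => (f t z, g t z)) _).
by move=> s t u z; rewrite !map_act.
Defined.

Definition prodmap n (X Y X' Y' : msset n) (f : msmap X X') (g : msmap Y Y') :
  msmap (prodms X Y) (prodms X' Y').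
Proof.
refine (@MSmap n (prodms X Y) (prodms X' Y') (fun t z => (f t z.1, g t z.2)) _).
by move=> s t u z; rewrite /= !map_act.
Defined.

(* An element w of W(0, ..., 0) is a map to W from the terminal n-fold category;
   [point w t] is its value at level t. *)
Definition point n (W : msset n) (w : W (zeros n)) t : W t := act W (mterm t) w.

Lemma act_point n (W : msset n) (w : W (zeros n)) s t (f : mor s t) :
  act W f (point w t) = point w s.
Proof. by rewrite /point -act_comp (mtermP (mcomp _ _)). Qed.

Definition fiber n (Z W : msset n) (g : msmap Z W) (w : W (zeros n)) : msset n.
Proof.
refine (@MSset n (fun t => {z : Z t | g t z = point w t})
  (fun s t f z => exist _ (act Z f (sval z)) _) _ _).
- by move=> s [z h]; apply: eq_exist; rewrite act_id.
- by move=> r s t v u [z h]; apply: eq_exist; rewrite act_comp.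
Unshelve.
by case: z => z h /=; rewrite map_act h act_point.
Defined.

Lemma fiber_valE n (Z W : msset n) (g : msmap Z W) w t (x y : fiber g w t) :
  sval x = sval y -> x = y.
Proof. by case: x y => [x hx] [y hy] /= h; apply: eq_exist. Qed.

Definition fiber_incl n (Z W : msset n) (g : msmap Z W) w : msmap (fiber g w) Z.
Proof. by refine (@MSmap n (fiber g w) Z (fun t z => sval z) _). Defined.

(* The inclusions of unions of connected components, and the isomorphisms. *)
Definition summand n (Y Z : msset n) (i : msmap Y Z) : Prop :=
  (forall t, injective (i t)) /\
  forall s t (f : mor s t) z y, act Z f z = i s y -> exists y', z = i t y'.

Lemma summand_segal n (Y Z : msset n.+1) (i : msmap Y Z) : summand i -> segal Z -> segal Y.
Proof.
move=> [inj sat] hZ k t k2; have [h hK Kh] := hZ k t k2.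
have ci (x : chain Y k t) (a b : 'I_k) : b = a.+1 :> nat ->
    sd0 Z t (i (1, t) (sval x a)) = sd1 Z t (i (1, t) (sval x b)).
  by move=> e; have := svalP x a b e; rewrite /= -!map_act => ->.
pose ix x : chain Z k t := exist _ _ (ci x).
have Kix x a : slice_op Z (dspine a) t (h (ix x)) = i (1, t) (sval x a).
  exact: (congr1 (fun c : chain Z k t => sval c a) (Kh (ix x))).
have lift x : {y : Y (k, t) | h (ix x) = i (k, t) y}.
  by apply: cid; apply: sat (Kix x (Ordinal (ltnW k2))).
exists (fun x => sval (lift x)) => [y|x].
  apply: inj; rewrite -(svalP (lift _)) -[RHS]hK; congr h; apply: eq_exist.
  by apply: funext => a; rewrite /= map_act.
case: (lift x) => y /= hy; case: x hy => x hx hy; apply: eq_exist.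
by apply: funext => a; apply: inj; rewrite -[RHS](Kix (exist _ x hx)) hy /= map_act.
Qed.

Section SummandSset.
Variables (Y Z : msset 1) (i : msmap Y Z).
Hypothesis hi : summand i.

Lemma summand_slice_op k l (f : dhom k l) z y :
  slice_op Z f tt z = i (k, tt) y ->
  exists2 y', z = i (l, tt) y' & slice_op Y f tt y' = y.
Proof.
case: hi => inj sat e; have [y' ez] := sat _ _ _ _ _ e; exists y' => //.
by apply: inj; rewrite -e ez /= map_act.
Qed.

Lemma summand_composite u v w :
  composite (i (1, tt) u) (i (1, tt) v) (i (1, tt) w) -> composite u v w.
Proof.
case: (hi) => inj sat [z [e2 e0 e1]]; have [z' ez e2'] := summand_slice_op e2.
by exists z'; split=> //; apply: inj; rewrite -?e0 -?e1 ez /= map_act.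
Qed.

Lemma summand_invertible u : invertible (i (1, tt) u) -> invertible u.
Proof.
case=> v [h1 h2]; have [v' ev] : exists v', v = i (1, tt) v'.
  case: (h1) => z [e2 e0 _]; have [z' ez _] := summand_slice_op e2.
  by exists (slice_op Y (dface (inord 0 : 'I_3)) tt z'); rewrite -e0 ez /= map_act.
exists v'; split; apply: summand_composite.
- by rewrite -idar_map -src_map -ev.
- by rewrite -idar_map -tgt_map -ev.
Qed.

Lemma summand_arr_src u y : src u = i (0, tt) y -> exists2 u', u = i (1, tt) u' & src u' = y.
Proof. exact: summand_slice_op. Qed.

Lemma summand_arr_tgt u y : tgt u = i (0, tt) y -> exists2 u', u = i (1, tt) u' & tgt u' = y.
Proof. exact: summand_slice_op. Qed.

Lemma summand_isomorphic x y : isomorphic (i (0, tt) x) (i (0, tt) y) -> isomorphic x y.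
Proof.
case=> u [e1 e0 h]; have [u' eu es] := summand_arr_src e1.
exists u'; split=> //; last by apply: summand_invertible; rewrite -eu.
by have [inj _] := hi; apply: inj; rewrite -tgt_map -eu.
Qed.

Lemma summand_clos x z :
  clos_refl_sym_trans (ob Z) (@isomorphic Z) x z ->
  (forall y, x = i (0, tt) y -> exists2 y', z = i (0, tt) y' &
     clos_refl_sym_trans (ob Y) (@isomorphic Y) y y') /\
  (forall y, z = i (0, tt) y -> exists2 y', x = i (0, tt) y' &
     clos_refl_sym_trans (ob Y) (@isomorphic Y) y y').
Proof.
elim=> {x z} [x z|x|x z _ [h1 h2]|x y z _ [h1 h2] _ [h3 h4]].
- move=> hxz; split=> y e.
    have [u [es et hu]] := hxz; have [u' eu _] := summand_arr_src (etrans es e).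
    exists (tgt u'); first by rewrite -et eu tgt_map.
    apply/rst_step/summand_isomorphic; rewrite -e -tgt_map -eu et.
    by exists u.
  have [u [es et hu]] := hxz; have [u' eu _] := summand_arr_tgt (etrans et e).
  exists (src u'); first by rewrite -es eu src_map.
  apply/rst_sym/rst_step/summand_isomorphic; rewrite -e -src_map -eu es.
  by exists u.
- by split=> y e; exists y => //; exact: rst_refl.
- by split.
- split=> a e.
    have [b /h3[c ec hc] hb] := h1 a e; exists c => //; exact: rst_trans hb hc.
  have [b /h2[c ec hc] hb] := h4 a e; exists c => //; exact: rst_trans hb hc.
Qed.

Lemma summand_equiv_relation : equiv_relation Z -> equiv_relation Y.
Proof.
move=> [[hs hg] [S [g [r [[h [h1 h2]] [k [k1 _]]]]]]].
have [inj sat] := hi.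
split; first by split; [exact: summand_segal hs|move=> u; exact/summand_invertible].
pose vx l : @mor 1 (0, tt) (l, tt) := (dvert ord0, tt).
pose S' := {s : S | exists y, r (0, tt) s = i (0, tt) y}.
have gP l (y : Y l) : exists y', r (0, tt) (g l (i l y)) = i (0, tt) y'.
  case: l y => l [] y; pose v := act Y (vx l) y.
  have ev : g (l, tt) (i (l, tt) y) = g (0, tt) (i (0, tt) v).
    by rewrite /v !map_act.
  have [e0 e1 _] := h1 (i (0, tt) v); rewrite ev.
  have [u' eu _] := summand_arr_tgt e1; exists (src u').
  by rewrite -src_map -eu e0.
have @g' : msmap Y (d (set_msset S')).
  refine (@MSmap 1 Y (d (set_msset S')) (fun l y => exist _ (g l (i l y)) (gP l y)) _).
  by move=> l m f y; apply: eq_exist; rewrite !map_act.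
have rP l (s : S') : {y | r l (sval s) = i l y}.
  apply: cid; case: s l => s [y /= e] [l []].
  apply: (sat _ _ (vx l)).
  by rewrite -map_act; exact: e.
have @r' : msmap (d (set_msset S')) Y.
  refine (@MSmap 1 (d (set_msset S')) Y (fun l s => sval (rP l s)) _).
  move=> l m f s; apply: inj; rewrite map_act -(svalP (rP m s)) -(svalP (rP l _)).
  by rewrite -map_act.
have ir' l s : i l (r' l s) = r l (sval s) by rewrite (svalP (rP l s)).
have gr l s : g (l, tt) (r (l, tt) s) = s.
  have e : g (0, tt) (r (0, tt) s) = s by have [e0 e1 _] := k1 s; exact: etrans (esym e0) e1.
  rewrite -[RHS]e; change (g (l, tt) (r (l, tt) s)) with
    (act (d (set_msset S)) (vx l) (g (l, tt) (r (l, tt) s))).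
  by rewrite -!map_act.
exists S', g', r'; split.
  have [h' hP] : exists h', forall y, h (i (0, tt) y) = i (1, tt) (h' y).
    suff hP y : {u | h (i (0, tt) y) = i (1, tt) u}.
      by exists (fun y => sval (hP y)) => y; exact: svalP (hP y).
    apply: cid; have [_ /summand_arr_tgt [u -> _] _] := h1 (i (0, tt) y).
    by exists u.
  exists h'; split=> [y|u].
    have [e0 e1 e2] := h1 (i (0, tt) y).
    split; last by apply: summand_invertible; rewrite -hP.
    - by apply: (@inj _); rewrite -src_map -hP e0 [RHS]ir'.
    - by apply: (@inj _); rewrite -tgt_map -hP e1.
  have [w [w1 w2]] := h2 (i (1, tt) u).
  rewrite src_map tgt_map !hP in w1 w2.
  have [w' ew] : exists w', w = i (1, tt) w'.
    case: (w2) => z [/summand_slice_op [z' ez _] _ <-].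
    by exists (slice_op Y (dface (inord 1 : 'I_3)) tt z'); rewrite ez /= map_act.
  exists w'; split; apply: summand_composite; rewrite -ew //.
  by rewrite /= ir'.
have g'r' l s : g' (l, tt) (r' (l, tt) s) = s.
  by case: s => s hs'; apply: eq_exist; rewrite ir' gr.
exists id; split=> [s|u].
  by split; [exact: esym (g'r' 0 s)|by []|exists s; split; exists s].
by exists u; split; exists u; split=> //; exact: esym (g'r' 1 u).
Qed.
End SummandSset.

Lemma summand_slice n (Y Z : msset n.+1) (i : msmap Y Z) k :
  summand i -> summand (slice_map i k).
Proof.
move=> [inj sat]; split=> [t|s t f z y]; first exact: inj.
exact: (sat (k, s) (k, t)).
Qed.

Lemma summand_row n (Y Z : msset n.+1) (i : msmap Y Z) t :
  summand i -> summand (row_map i t).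
Proof.
move=> [inj sat]; split=> [k|k l f z y]; first exact: inj.
exact: sat.
Qed.

Lemma summand_p n (Y Z : msset n.+1) (i : msmap Y Z) : summand i -> summand (p_map i).
Proof.
move=> hi; split=> [t a b|s t f c a].
  rewrite -(iso_reprK a) -(iso_reprK b) /= !iso_classes_mapE => /iso_classP.
  move/(summand_clos (summand_row t hi)) => [/(_ _ (erefl _)) [y e h] _].
  by apply/iso_classP; have [inj _] := summand_row t hi; rewrite (inj _ _ _ e).
rewrite -(iso_reprK c) -(iso_reprK a) /= !iso_classes_mapE => /iso_classP.
move/(summand_clos (summand_row s hi)) => [_ /(_ _ (erefl _)) [y e _]].
have [_ sat] := hi; have [y' ->] := sat _ _ _ _ _ e.
by exists (iso_class (y' : ob (row Y t))); rewrite /= iso_classes_mapE.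
Qed.

Lemma summand_hdS n (Y Z : msset n.+1) (i : msmap Y Z) : summand i -> hdS Z -> hdS Y.
Proof.
elim: n Y Z i => [|n IH] Y Z i hi; first exact: summand_equiv_relation hi.
case=> h1 h2 h3; split; last exact: IH (summand_p hi) h3.
  by move=> k; exact: IH (summand_slice k hi) (h1 k).
exact: summand_segal hi h2.
Qed.

Definition constant n (W : msset n) : Prop := forall s t (f : mor s t), injective (act W f).

Lemma constant_disc n (X : msset n) : constant (disc X).
Proof.
elim: n X => [|n IH] X [] //=; last by move=> k s t f; exact: IH.
by move=> [] [] x y; rewrite !(act_id (m := X) (s := tt)).
Qed.

Lemma summand_fiber n (Z W : msset n) (g : msmap Z W) w :
  constant W -> summand (fiber_incl g w).
Proof.
move=> cW; split=> [t x y|s t f z y e]; first exact: fiber_valE.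
have h : g t z = point w t.
  by apply: (cW _ _ f); rewrite -map_act e act_point; exact: svalP y.
by exists (exist _ z h).
Qed.

Section Hom.
Variables (n : nat) (X : hdcat n.+2).

Definition homs_base : msset n.+1 := prodms (disc (slice X 0)) (disc (slice X 0)).

Definition homs_map : msmap (slice X 1) homs_base :=
  compmap (prodmap (gamma (hdslice X 0)) (gamma (hdslice X 0)))
          (pairmap (sd0 X) (sd1 X)).

(* The underlying set of (X_0)^d. *)
Definition hpt : Type := disc (slice X 0) (zeros n.+1).

Definition hom_fiber (a b : hpt) : msset n.+1 :=
  @fiber _ (slice X 1) homs_base homs_map (a, b).

Lemma hd_hom_fiber a b : hd (hom_fiber a b).
Proof.
apply: summand_hdS (hd_slice X 1); apply: summand_fiber => s t f [x y] [x' y'] [e1 e2].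
by rewrite (constant_disc e1) (constant_disc e2).
Qed.

(* [hom X a b] is X(a, b). *)
Definition hom (a b : hpt) : hdcat n.+1 := HdCat (hd_hom_fiber a b).

End Hom.

Arguments hom {n} X a b.

Section HomMap.
Variables (n : nat) (X Y : hdcat n.+2) (f : msmap X Y).

Definition hpt_map : hpt X -> hpt Y := disc_map (slice_map f 0) (zeros n.+1).

Lemma hom_map_subproof (a b : hpt X) t (z : hom X a b t) :
  homs_map Y t (slice_map f 1 t (sval z))
    = @point _ (homs_base Y) (hpt_map a, hpt_map b) t.
Proof.
case: z => z e; apply: (f_equal2 pair).
  have e1 : gamma (hdslice X 0) t (sd0 X t z) = point a t := congr1 fst e.
  have e0 : sd0 Y t (f (1, t) z) = slice_map f 0 t (sd0 X t z) by rewrite /= map_act.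
  rewrite [LHS](congr1 (gamma (hdslice Y 0) t) e0).
  by rewrite (@gamma_natural _ (hdslice X 0) (hdslice Y 0)) e1 map_act.
have e1 : gamma (hdslice X 0) t (sd1 X t z) = point b t := congr1 snd e.
have e0 : sd1 Y t (f (1, t) z) = slice_map f 0 t (sd1 X t z) by rewrite /= map_act.
rewrite [LHS](congr1 (gamma (hdslice Y 0) t) e0).
by rewrite (@gamma_natural _ (hdslice X 0) (hdslice Y 0)) e1 map_act.
Qed.

(* [hom_map f a b] is f(a, b). *)
Definition hom_map a b : msmap (hom X a b) (hom Y (hpt_map a) (hpt_map b)).
Proof.
refine (@MSmap _ (hom X a b) (hom Y (hpt_map a) (hpt_map b))
  (fun t z => exist _ _ (hom_map_subproof z)) _).
by move=> s t u z; apply: fiber_valE; rewrite /= map_act.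
Defined.

End HomMap.

Arguments hom_map {n X Y} f a b.

(* [nequiv n f] says that f, a map in Cat^(n+1)_hd, is an (n+1)-equivalence. *)
Fixpoint nequiv n : forall X Y : hdcat n.+1, msmap X Y -> Prop :=
  match n with
  | 0 => fun X Y f => is_equivalence f
  | n'.+1 => fun X Y f =>
      (forall a b : hpt X, nequiv (hom_map f a b)) /\
      @nequiv n' (hdp X) (hdp Y) (p_map f)
  end.

(* Main.v *)
Require Import Defs.
From Stdlib Require Import Relations.
From mathcomp Require Import all_boot boolp.

Set Implicit Arguments.
Unset Strict Implicit.
Unset Printing Implicit Defensive.

(** For X in Cat^n_hd the discretization map gamma_(n) : X -> X^d is onto and
identifies two simplices exactly when they lie in the same connected component
of X, so that X^d is the constant multisimplicial set on the components of X.
The map f^d is therefore invertible if and only if f is bijective on components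
([is_iso_disc_map]), and the theorem becomes: f is an n-equivalence if and only
if it is bijective on components ([nequivP]), which is proved by induction on n.

For n = 1 this says that a functor between equivalence relations is an
equivalence exactly when it is bijective on isomorphism classes: an
equivalence relation has at most one arrow between two objects, so an inverse
on classes lifts to a functor and naturality is automatic.

For the inductive step, X and p X have the same components, so the condition on
p f says that f is bijective on components. The conditions on the f(a, b) then
follow. The components of X_0 and of X_1 are the objects and the arrows of an
equivalence relation, obtained from X by applying p in all directions but the
first, whose quotient is the set of components of X. Hence X(a, b), the union
of the components of X_1 lying over (a, b), has at most one component
([hom_connected]), and is inhabited exactly when a and b are in the same
component of X ([hom_inhabited]). If f is bijective on components and
Y(fa, fb) is inhabited, then a and b are already connected in X, so X(a, b) is
inhabited, and f(a, b) is a bijection between sets with at most one component.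

The facts about components pass between X and p X by [connected_gamma1] and
[connected_slice_gamma1], which is what allows induction on n. *)

(** * Connected components of a multisimplicial set *)

Definition invariant_family n (X : msset n) (P : forall s, X s -> Prop) : Prop :=
  forall s t (f : mor s t) x, P s (act X f x) <-> P t x.

(** Equality of the classes of x and y in the colimit of X. Quantifying over the
invariant families avoids zigzags of simplices, and lets x and y sit at
different levels, which saves transporting along equations between indices. *)
Definition connected n (X : msset n) s (x : X s) t (y : X t) : Prop :=
  forall P, invariant_family (X := X) P -> P s x <-> P t y.

Section Connected.
Variables (n : nat) (X : msset n).

Lemma connected_refl s (x : X s) : connected x x.
Proof. by []. Qed.

Lemma connected_sym s (x : X s) t (y : X t) : connected x y -> connected y x.
Proof. by move=> h P hP; rewrite (h P hP). Qed.

Lemma connected_trans s (x : X s) t (y : X t) r (z : X r) :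
  connected x y -> connected y z -> connected x z.
Proof. by move=> h k P hP; rewrite (h P hP) (k P hP). Qed.

Lemma connected_act s t (f : mor s t) (x : X t) : connected (act X f x) x.
Proof. by move=> P hP; exact: hP. Qed.

End Connected.

Lemma connected_map n (X Y : msset n) (f : msmap X Y) s (x : X s) t (y : X t) :
  connected x y -> connected (f s x) (f t y).
Proof.
move=> h P hP; apply: (h (fun r z => P r (f r z))) => r u g z.
by rewrite map_act hP.
Qed.

Lemma connected_slice n (X : msset n.+1) k s (x : slice X k s) t (y : slice X k t) :
  connected x y -> @connected _ X (k, s) x (k, t) y.
Proof.
move=> h P hP; apply: (h (fun r z => P (k, r) z)) => r u g z.
exact: (hP (k, r) (k, u) (did k, g) z).
Qed.

(** An invariant family on a union of components extends by the empty family to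
an invariant family on the whole. *)
Lemma connected_summand n (Y Z : msset n) (i : msmap Y Z) s (x : Y s) t (y : Y t) :
  summand i -> connected (i s x) (i t y) -> connected x y.
Proof.
move=> [inj sat] h P hP.
have PE r (z : Y r) : (exists2 z', i r z' = i r z & P r z') <-> P r z.
  by split=> [[z' /inj->]|]; last by exists z.
rewrite -(PE s x) -(PE t y).
apply: (h (fun r z => exists2 z', i r z' = z & P r z')) => r u g z; split.
  move=> [z' e Pz']; have [z'' ez] := sat _ _ _ _ _ (esym e); exists z'' => //.
  by apply/(hP _ _ g); suff -> : act Y g z'' = z' by []; apply: inj; rewrite map_act -ez.
by move=> [z' <- Pz']; exists (act Y g z'); [rewrite map_act|apply/hP].
Qed.

Lemma connected_d n (Z : msset n) s (x : d Z s) t (y : d Z t) :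
  connected x y -> @connected _ Z (init s) x (init t) y.
Proof.
move=> h P hP; apply: (h (fun r z => P (init r) z)) => r u g z.
exact: (hP _ _ (minit g) z).
Qed.

Fixpoint mvertex n : forall s : idx n, mor (zeros n) s :=
  match n with
  | 0 => fun _ => tt
  | n'.+1 => fun s => (dvert ord0, mvertex s.2)
  end.

Section Constant.
Variables (n : nat) (W : msset n).
Hypothesis cW : Defs.constant W.

Lemma constant_point s (x : W s) : exists w, x = point w s.
Proof.
exists (act W (mvertex s) x); apply: (cW (f := mvertex s)).
by rewrite act_point /point -(mtermP (mid _)) act_id.
Qed.

Lemma connected_constant s (x y : W s) : connected x y -> x = y.
Proof.
have [w ->] := constant_point x => h; apply/esym.
apply: (proj1 (h (fun r z => z = point w r) _)) => // r u f z.
by split=> [e|->]; [apply: (cW (f := f)); rewrite e act_point|rewrite act_point].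
Qed.

End Constant.

(** * Components and discretization *)

Lemma init_surj n (t : idx n) : exists s, init s = t.
Proof.
elim: n t => [|n IH] /=; first by case; exists (0, tt).
by case=> k t; have [s <-] := IH t; exists (k, s).
Qed.

(** A retraction of [mvert] on indices, which makes [gamma1] onto at each level. *)
Fixpoint mcollapse n : forall s : idx n.+1, mor s (snoc (init s) 0) :=
  match n with
  | 0 => fun s => (dterm s.1, tt)
  | n'.+1 => fun s => (did s.1, mcollapse s.2)
  end.

Lemma mcollapseK n (s : idx n.+1) : mcomp (mcollapse s) (mvert s) = mid (snoc (init s) 0).
Proof.
elim: n s => [|n IH] s; last exact: (f_equal2 pair (dcomp1f _) (IH _)).
by congr pair; apply: dhomP => i; rewrite !ord1.
Qed.

Lemma gamma1_surj n (X : hdcat n.+1) s (c : p X (init s)) : exists x, gamma1 X s x = c.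
Proof.
exists (act X (mcollapse s) (iso_repr c)).
by rewrite -[RHS]iso_reprK /= -act_comp mcollapseK act_id.
Qed.

Lemma gamma_surj n (X : hdcat n) s (c : disc X s) : exists x, gamma X s x = c.
Proof.
elim: n X s c => [|n IH] X s c; first by exists c.
have [b <-] := IH (hdp X) (init s) c; have [x <-] := gamma1_surj b.
by exists x.
Qed.

(** An isomorphism in a row is a simplex having its source and its target as
faces. *)
Lemma isomorphic_connected n (X : msset n.+1) t (x y : ob (row X t)) :
  clos_refl_sym_trans (ob (row X t)) (@isomorphic (row X t)) x y ->
  @connected _ X _ x _ y.
Proof.
elim=> {x y} [x y|x|x y _ h|x y z _ h _ k].
- move=> [u [<- <- _]]; apply: (@connected_trans _ X _ _ _ (u : X (snoc t 1))).
    exact: (@connected_act _ X _ _ (msnoc (mid t) (dface (ord_max : 'I_2))) u).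
  apply: connected_sym.
  exact: (@connected_act _ X _ _ (msnoc (mid t) (dface (ord0 : 'I_2))) u).
- exact: connected_refl.
- exact: connected_sym.
- exact: connected_trans h k.
Qed.

(** An invariant family takes the same value on isomorphic objects of a row, so
it descends to the isomorphism classes. *)
Lemma iso_class_connected n (X : msset n.+1) s t (x : ob (row X s)) (y : ob (row X t)) :
  connected (iso_class x : p X s) (iso_class y : p X t) -> @connected _ X _ x _ y.
Proof.
move=> h P hP.
have PE r (z : ob (row X r)) : P (snoc r 0) (iso_repr (iso_class z)) <-> P (snoc r 0) z.
  by apply: (isomorphic_connected _ hP); apply/iso_classP; rewrite iso_reprK.
rewrite -PE -(PE t); apply: (h (fun r c => P (snoc r 0) (iso_repr c))) => r u f c.
by rewrite -{1}(iso_reprK c) /= iso_classes_mapE PE hP.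
Qed.

(** The rows of [slice X k] and of [X] carry the same simplices and the same
operators but different proofs of functoriality, so their types of isomorphism
classes are distinct; passing through representatives compares them. *)
Lemma iso_class_slice n (X : msset n.+2) k t (x : ob (row X (k, t))) :
  @iso_class (row (slice X k) t) (iso_repr (iso_class x)) = @iso_class (row (slice X k) t) x.
Proof.
apply/iso_classP; exact: (proj1 (@iso_classP (row X (k, t)) _ _) (iso_reprK _)).
Qed.

Lemma slice_p_map_subproof n (X : msset n.+2) k s t (f : mor s t) (c : slice (p X) k t) :
  @iso_class (row (slice X k) s) (iso_repr (act (slice (p X) k) f c)) =
  act (p (slice X k)) f (@iso_class (row (slice X k) t) (iso_repr c)).
Proof. by rewrite /= iso_classes_mapE iso_class_slice. Qed.

Definition slice_p_map n (X : msset n.+2) k : msmap (slice (p X) k) (p (slice X k)) :=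
  @MSmap n (slice (p X) k) (p (slice X k))
    (fun t c => @iso_class (row (slice X k) t) (iso_repr c)) (@slice_p_map_subproof n X k).

(** X and p X have the same components: this carries every induction on the
dimension below. *)
Lemma connected_gamma1 n (X : hdcat n.+1) s (x : X s) t (y : X t) :
  @connected _ (p X) (init s) (gamma1 X s x) (init t) (gamma1 X t y) <-> connected x y.
Proof.
split=> h.
  have {}h := iso_class_connected h.
  apply: connected_trans (connected_act (mvert t) y).
  apply: (connected_trans _ h); apply: connected_sym; exact: connected_act.
exact: (connected_d (connected_map (gamma1 X) h)).
Qed.

(** The same in a slice. From left to right, p X at level k is first compared
with p of X_k. *)
Lemma connected_slice_gamma1 n (X : hdcat n.+2) k s (x : slice X k s) t (y : slice X k t) :
  @connected _ (slice (p X) k) (init s) (gamma1 X (k, s) x) (init t) (gamma1 X (k, t) y)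
  <-> connected x y.
Proof.
split=> h.
  have {}h := connected_map (slice_p_map X k) h.
  apply/(connected_gamma1 (X := hdslice X k)).
  by move: h; rewrite /= !iso_class_slice.
exact: (@connected_d _ (slice (p X) k) _ _ _ _ (connected_map (slice_map (gamma1 X) k) h)).
Qed.

Lemma gamma_connected n (X : hdcat n) s (x : X s) t (y : X t) :
  connected (gamma X s x) (gamma X t y) -> connected x y.
Proof.
elim: n X s x t y => [|n IH] X s x t y //.
by move=> h; apply/connected_gamma1; apply: (IH (hdp X)); exact: connected_d h.
Qed.

Lemma point_connected n (W : msset n) (w : W (zeros n)) s t :
  connected (point w s) (point w t).
Proof.
apply: (connected_trans (connected_act _ _)); apply: connected_sym; exact: connected_act.
Qed.

Definition component_bijection n (X Y : msset n) (f : msmap X Y) : Prop :=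
  (forall s (x : X s) t (y : X t), connected (f s x) (f t y) -> connected x y) /\
  forall t (y : Y t), exists s (x : X s), connected (f s x) y.

Lemma connected_gamma n (X : hdcat n) s (x y : X s) :
  connected x y -> gamma X s x = gamma X s y.
Proof. by move=> h; apply: (connected_constant (@constant_disc _ X)); exact: connected_map. Qed.

(** Since gamma is onto and its fibers are the components, f^d is the map
induced by f on components, repeated at each level. *)
Lemma is_iso_disc_map n (X Y : hdcat n) (f : msmap X Y) :
  is_iso (disc_map f) <-> component_bijection f.
Proof.
split=> [[g [gK Kg]]|[inj surj]].
  split=> [s x t y h|t y].
    apply: gamma_connected.
    have := connected_map g (connected_map (gamma Y) h).
    by rewrite !gamma_natural !gK.
  have [x ex] := gamma_surj (g t (gamma Y t y)); exists t, x.
  by apply: gamma_connected; rewrite gamma_natural ex Kg.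
have dinj s : injective (disc_map f s).
  move=> a b; have [x <-] := gamma_surj a; have [y <-] := gamma_surj b.
  rewrite -!gamma_natural => e.
  by apply: connected_gamma; apply: inj; apply: (gamma_connected (X := Y)); rewrite e.
have dsurj s c : {a | disc_map f s a = c}.
  apply: cid; have [y <-] := gamma_surj c; have [t [x h]] := surj s y.
  have [w e] := constant_point (@constant_disc _ X) (gamma X t x).
  (* x may live at a level other than s: move its class there through w. *)
  exists (point w s); apply: (connected_constant (@constant_disc _ Y)).
  apply: (connected_trans (connected_map (disc_map f) (point_connected w s t))).
  by rewrite -e -gamma_natural; exact: connected_map.
have gact s t (u : mor s t) c :
    sval (dsurj s (act (disc Y) u c)) = act (disc X) u (sval (dsurj t c)).
  by apply: dinj; rewrite map_act (svalP (dsurj s _)) (svalP (dsurj t _)).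
exists (MSmap gact); split=> s c /=; last exact: svalP (dsurj s c).
by apply: dinj; rewrite (svalP (dsurj s _)).
Qed.

Lemma component_bijection_p n (X Y : hdcat n.+1) (f : msmap X Y) :
  component_bijection (p_map f) <-> component_bijection f.
Proof.
have fE s x : gamma1 Y s (f s x) = p_map f (init s) (gamma1 X s x).
  by rewrite /= iso_classes_mapE /= map_act.
split=> [[inj surj]|[inj surj]]; split.
- move=> s x t y h; apply: (proj1 (connected_gamma1 _ _)); apply: inj.
  by rewrite -(fE s) -(fE t); apply: (proj2 (connected_gamma1 _ _)).
- move=> t y; have [s0 [c h]] := surj _ (gamma1 Y t y).
  have [s es] := init_surj s0; case: s0 / es c h => c.
  have [x <-] := gamma1_surj c; rewrite -fE => h; have {}h := proj1 (connected_gamma1 _ _) h.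
  by exists s, x.
- move=> s0 c t0 b; have [s es] := init_surj s0; case: s0 / es c => c.
  have [t et] := init_surj t0; case: t0 / et b => b.
  have [x <-] := gamma1_surj c; have [y <-] := gamma1_surj b.
  rewrite -!fE => h; have {}h := inj _ _ _ _ (proj1 (connected_gamma1 _ _) h).
  exact: (proj2 (connected_gamma1 _ _) h).
- move=> t0 b; have [t et] := init_surj t0; case: t0 / et b => b.
  have [y <-] := gamma1_surj b; have [s [x h]] := surj t y.
  by exists (init s), (gamma1 X s x); rewrite -fE; apply: (proj2 (connected_gamma1 _ _)).
Qed.

(** * Equivalence relations *)

Section EquivRelation.
Variables (X : msset 1) (hX : equiv_relation X).

(** The functor q to a discrete category is constant on components, and x is
isomorphic to r (q x). *)
Lemma connected_isomorphic (x y : ob X) : connected x y -> isomorphic x y.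
Proof.
have [[hs _] [S [q [r [[h [h1 _]] _]]]]] := hX => c.
have e : q (0, tt) x = q (0, tt) y.
  apply: (connected_constant (W := d (set_msset S))); last exact: connected_map.
  by move=> s t f a b.
have [_ tr sy] := isomorphic_equivalence hs.
have iso z : isomorphic (r (0, tt) (q (0, tt) z)) z by exists (h z); exact: h1 z.
by apply: tr (iso y); rewrite -e; exact: sy.
Qed.

(** The natural isomorphism from r q to the identity and the fact that q sends
parallel arrows to the same identity give h u = h v for an invertible h. *)
Lemma parallel_eq (u v : arr X) : src u = src v -> tgt u = tgt v -> u = v.
Proof.
have [[hs _] [S [q [r [[h [h1 h2]] _]]]]] := hX => es et.
have qE w : q (1, tt) w = q (0, tt) (src w) by rewrite /src /= map_act.
have [w [a b]] := h2 u; have [w' [a' b']] := h2 v.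
move: a b a' b'; rewrite /= !qE es et => a b a' b'.
rewrite -(composite_uniq hs a a') in b'.
have [_ _ [k [_ hk]]] := h1 (src v).
have cancel z : composite (h (src v)) z w -> composite k w z.
  move=> hz; apply: (proj1 (compositeA hs z hk hz)).
  by rewrite (composite_mid hz); exact: composite_idl.
by rewrite (composite_uniq hs (cancel _ b) (cancel _ b')).
Qed.

End EquivRelation.

Lemma nat_iso_connected (X Y : msset 1) (f g : msmap X Y) s (x : X s) :
  nat_iso f g -> connected (f s x) (g s x).
Proof.
move=> [h [h1 _]]; pose v := act X (mvertex s) x.
have [es et _] := h1 v.
have fv : connected (f s x) (f (0, tt) v).
  by rewrite /v map_act; apply: connected_sym; exact: connected_act.
have gv : connected (g (0, tt) v) (g s x) by rewrite /v map_act; exact: connected_act.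
apply: (connected_trans fv); apply: (connected_trans _ gv); rewrite -es -et.
apply: (@connected_trans _ Y _ _ _ (h v)); first exact: connected_act.
by apply: connected_sym; exact: connected_act.
Qed.

(** Isomorphisms may be chosen arbitrarily at each object: the naturality
squares commute because parallel arrows of Y are equal. *)
Lemma connected_nat_iso (X Y : msset 1) (f g : msmap X Y) :
  equiv_relation Y -> (forall x : ob X, connected (f (0, tt) x) (g (0, tt) x)) ->
  nat_iso f g.
Proof.
move=> hY c; have [[hs _] _] := hY.
have hP x : {u | [/\ src u = f (0, tt) x, tgt u = g (0, tt) x & invertible u]}.
  by apply: cid; exact: connected_isomorphic (c x).
pose h x := sval (hP x).
have h1 x : [/\ src (h x) = f (0, tt) x, tgt (h x) = g (0, tt) x & invertible (h x)].
  exact: svalP (hP x).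
exists h; split=> // u.
have [s1 t1 _] := h1 (src u); have [s2 t2 _] := h1 (tgt u).
have [w cw] : exists w, composite (f (1, tt) u) (h (tgt u)) w.
  by apply: composite_ex => //; rewrite s2 tgt_map.
have [w' cw'] : exists w, composite (h (src u)) (g (1, tt) u) w.
  by apply: composite_ex => //; rewrite t1 src_map.
exists w; split=> //; suff -> : w = w' by [].
apply: (parallel_eq hY).
  by rewrite (composite_src cw) (composite_src cw') s1 src_map.
by rewrite (composite_tgt cw) (composite_tgt cw') t2 tgt_map.
Qed.

(** The inverse functor is the composite Y -> T -> S -> X through the sets of
classes T of Y and S of X, where sigma : T -> S inverts f on classes. *)
Lemma is_equivalenceP (X Y : msset 1) (f : msmap X Y) :
  equiv_relation X -> equiv_relation Y -> is_equivalence f <-> component_bijection f.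
Proof.
move=> hX hY; split=> [[g [gf fg]]|[inj surj]].
  split=> [s x t y h|t y]; last by exists t, (g t y); exact: nat_iso_connected fg.
  apply: (connected_trans (connected_sym (nat_iso_connected x gf))).
  exact: (connected_trans (connected_map g h) (nat_iso_connected y gf)).
have [_ [S [q [r [qr rq]]]]] := hX; have [_ [T [q' [r' [qr' rq']]]]] := hY.
have surj0 (y : ob Y) : {x : ob X | connected (f (0, tt) x) y}.
  apply: cid; have [s [x h]] := surj _ y; exists (act X (mvertex s) x).
  by rewrite map_act; exact: connected_trans (connected_act _ _) h.
pose sigma (t : T) : S := q (0, tt) (sval (surj0 (r' (0, tt) t))).
have gact s t (u : mor s t) y :
  r s (sigma (q' s (act Y u y))) = act X u (r t (sigma (q' t y))).
  by rewrite -map_act map_act.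
pose g : msmap Y X := @MSmap 1 Y X (fun s y => r s (sigma (q' s y))) gact.
have fgP (y : ob Y) : connected (f (0, tt) (g (0, tt) y)) y.
  apply: (connected_trans (connected_map f (nat_iso_connected _ qr))).
  apply: (connected_trans (svalP (surj0 _))).
  exact: nat_iso_connected qr'.
exists g; split; apply: connected_nat_iso => // x.
by apply: inj; exact: fgP.
Qed.

(** * Components of the object of arrows *)

Lemma sd_gamma1 n (X : hdcat n.+2) (u : dhom 0 1) s (w : slice X 1 s) :
  slice_op (p X) u (init s) (gamma1 X (1, s) w) = gamma1 X (0, s) (slice_op X u s w).
Proof. by rewrite /slice_op [RHS]map_act [RHS]/= minit_id. Qed.

(** Arrows of the equivalence relation formed by the components of X_0 and X_1
are determined by their endpoints. Induction on n through p reduces this to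
parallel arrows of a one-dimensional X. *)
Lemma connected_parallel n (X : hdcat n.+1) s (v : slice X 1 s) t (w : slice X 1 t) :
  connected (sd0 X s v) (sd0 X t w) -> connected (sd1 X s v) (sd1 X t w) ->
  connected v w.
Proof.
elim: n X s v t w => [|n IH] X s v t w h0 h1.
  case: s v h0 h1; case: t w => w v h0 h1; suff -> : v = w by exact: connected_refl.
  apply: (parallel_eq (hdP X)); last exact: (connected_constant (@constant_disc 0 _) h0).
  exact: (connected_constant (@constant_disc 0 _) h1).
apply: (proj1 (connected_slice_gamma1 _ _)); apply: (IH (hdp X)); rewrite !sd_gamma1.
  exact: (proj2 (connected_slice_gamma1 _ _) h0).
exact: (proj2 (connected_slice_gamma1 _ _) h1).
Qed.

(** In the equivalence relation formed by the components of X_0 and X_1, two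
objects with the same class are joined by an arrow. *)
Lemma connected_arrow n (X : hdcat n.+1) s (x : slice X 0 s) t (y : slice X 0 t) :
  @connected _ X (0, s) x (0, t) y ->
  exists r (w : slice X 1 r), connected (sd0 X r w) x /\ connected (sd1 X r w) y.
Proof.
elim: n X s x t y => [|n IH] X s x t y h.
  case: s x h; case: t y => y x h.
  have [u [us ut _]] := connected_isomorphic (hdP X) (connected_sym h).
  exists tt, u; rewrite -[x]ut -[y]us.
  by split; exact: connected_refl.
have [r0 [c [h0 h1]]] := IH (hdp X) _ _ _ _ (proj2 (connected_gamma1 _ _) h).
have [r er] := init_surj r0; case: r0 / er c h0 h1 => c.
have [w <-] := @gamma1_surj _ X (1, r) c; rewrite !sd_gamma1 => h0 h1.
exists r, w; split; apply: (proj1 (connected_slice_gamma1 _ _)); [exact: h0|exact: h1].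
Qed.

(** * The fibers X(a, b) *)

Lemma point_gamma n (X : hdcat n) s (x : X s) t (y : X t) a :
  connected x y -> gamma X s x = point a s -> gamma X t y = point a t.
Proof.
move=> h; apply: (proj1 (h (fun r z => gamma X r z = point a r) _)) => r u f z.
rewrite map_act; split=> [e|->]; last exact: act_point.
by apply: (constant_disc (f := f)); rewrite e act_point.
Qed.

Lemma gamma_point_connected n (X : hdcat n) s (x : X s) t (y : X t) a :
  gamma X s x = point a s -> gamma X t y = point a t -> connected x y.
Proof.
by move=> ex ey; apply: gamma_connected; rewrite ex ey; exact: point_connected.
Qed.

Section Hom.
Variables (n : nat) (X : hdcat n.+2) (a b : hpt X).

Lemma hom_tgt t (z : hom X a b t) : gamma (hdslice X 0) t (sd0 X t (sval z)) = point a t.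
Proof. by case: z => z e; exact (congr1 fst e). Qed.

Lemma hom_src t (z : hom X a b t) : gamma (hdslice X 0) t (sd1 X t (sval z)) = point b t.
Proof. by case: z => z e; exact (congr1 snd e). Qed.

(** As a union of components of X_1, the fiber inherits connectedness from X_1,
where components are determined by their endpoints. *)
Lemma hom_connected s (z : hom X a b s) t (z' : hom X a b t) : connected z z'.
Proof.
apply: (connected_summand (i := fiber_incl _ _)).
  apply: summand_fiber => r u f [x y] [x' y'] [e1 e2].
  by rewrite (constant_disc e1) (constant_disc e2).
apply: connected_parallel.
  exact: (gamma_point_connected (X := hdslice X 0) (hom_tgt z) (hom_tgt z')).
exact: (gamma_point_connected (X := hdslice X 0) (hom_src z) (hom_src z')).
Qed.

Lemma hom_inhabited s (x : slice X 0 s) t (y : slice X 0 t) :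
  gamma (hdslice X 0) s x = point a s -> gamma (hdslice X 0) t y = point b t ->
  @connected _ X (0, s) x (0, t) y -> exists r, inhabited (hom X a b r).
Proof.
move=> ex ey /connected_arrow[r [w [h0 h1]]]; exists r; split.
exists w; apply: (f_equal2 pair).
  exact: (point_gamma (X := hdslice X 0) (connected_sym h0) ex).
exact: (point_gamma (X := hdslice X 0) (connected_sym h1) ey).
Qed.

End Hom.

(** Both fibers have at most one component, so it is enough to find a simplex
of X(a, b) given one of Y(fa, fb). The latter connects the images of a and b in
Y, and injectivity of f on components connects a and b in X. *)
Lemma component_bijection_hom n (X Y : hdcat n.+2) (f : msmap X Y) (a b : hpt X) :
  component_bijection f -> component_bijection (hom_map f a b).
Proof.
move=> [inj _]; split=> [s x t y _|t z]; first exact: hom_connected.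
have [x ex] := gamma_surj (X := hdslice X 0) (s := zeros n.+1) a.
have [y ey] := gamma_surj (X := hdslice X 0) (s := zeros n.+1) b.
suff [r [w]] : exists r, inhabited (hom X a b r) by exists r, w; exact: hom_connected.
have point0 (W : msset n.+1) (c : W (zeros n.+1)) : point c (zeros n.+1) = c.
  by rewrite /point -(mtermP (mid _)) act_id.
have fE c u : gamma (hdslice X 0) (zeros n.+1) u = c ->
    gamma (hdslice Y 0) (zeros n.+1) (slice_map f 0 (zeros n.+1) u)
      = point (disc_map (slice_map f 0) (zeros n.+1) c) (zeros n.+1).
  by move=> <-; rewrite point0 (@gamma_natural _ (hdslice X 0) (hdslice Y 0)).
apply: (hom_inhabited (x := x) (y := y)); rewrite ?point0 //; apply: inj.
have hx := gamma_point_connected (X := hdslice Y 0) (fE _ _ ex) (hom_tgt z).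
have hy := gamma_point_connected (X := hdslice Y 0) (fE _ _ ey) (hom_src z).
apply: (connected_trans (connected_slice hx)).
apply: (connected_trans _ (connected_sym (connected_slice hy))).
apply: (@connected_trans _ Y _ _ _ (sval z : Y (1, t))).
  exact: connected_act.
by apply: connected_sym; exact: connected_act.
Qed.

Lemma nequivP n (X Y : hdcat n.+1) (f : msmap X Y) : nequiv f <-> component_bijection f.
Proof.
elim: n X Y f => [|n IH] X Y f; first exact: is_equivalenceP (hdP X) (hdP Y).
split=> [[_ /(IH (hdp X) (hdp Y))]|h]; first by move/(component_bijection_p f).
split=> [a b|]; first by apply/IH; exact: component_bijection_hom.
by apply/(IH (hdp X) (hdp Y)); apply/component_bijection_p.
Qed.

Theorem lemma3p8 (n : nat) (X Y : hdcat n.+1) (f : msmap X Y) :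
  nequiv f <-> is_iso (disc_map f).
Proof. by split=> h; [apply/is_iso_disc_map/nequivP|apply/nequivP/is_iso_disc_map]. Qed.
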